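(* Let $H_1$ and $H_2$ be graphs. There exists a constant $c\in\mathbb{N}$ such that the class of $\{H_1, H_2\}$-free graphs is $c$-apex-split if and only if, up to switching the labels of $H_1$ and $H_2$, one of the following holds: 1. $H_1$ is an induced subgraph of $K_2$ or of $2K_1$, in which case one can take $c = 0$; 2. $H_1$ is an induced subgraph of $C_4$ and $H_2$ is an induced subgraph of $2K_2$, in which case one can take $c \leq 1$; 3. $H_1$ is a complete graph and $H_2$ is edgeless.
   Context: All graphs are finite and simple. $K_r$, $C_r$ denote the complete graph and cycle on $r$ vertices; $2H$ is the disjoint union of two copies of $H$. ''Induced subgraph of $X$'' means isomorphic to $X[S]$ for some $S\subseteq V(X)$. For a set $\mathcal{H}$ of graphs, a graph is $\mathcal{H}$-free if none of its induced subgraphs is isomorphic to a graph in $\mathcal{H}$. A split graph is a graph whose vertex set can be written as $K\cup S$ where $K$ is a clique and $S$ is a stable set (either may be empty). For $c\in\mathbb{N}$ (with $c=0$ allowed), a class of graphs is $c$-apex-split if every graph $G$ in the class has a set $X\subseteq V(G)$ with $|X|\le c$ such that $G-X$ is a split graph. *)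

(* Defs.v *)
From mathcomp Require Import all_boot.

Set Implicit Arguments.
Unset Strict Implicit.
Unset Printing Implicit Defensive.

Record sgraph := SGraph {
  vertex :> finType;
  adj : rel vertex;
  adj_sym : symmetric adj;
  adj_irr : irreflexive adj
}.

Definition graph_iso (G H : sgraph) : Prop :=
  exists2 f : G -> H, bijective f & forall x y, adj (f x) (f y) = adj x y.

(* X[S], with vertex type the subtype of elements of S. *)
Section Induced.
Variables (X : sgraph) (S : {set X}).
Definition induced_adj : rel {x : X | x \in S} :=
  fun x y => adj (val x) (val y).
Fact induced_sym : symmetric induced_adj.
Proof. by move=> x y; apply: adj_sym. Qed.
Fact induced_irr : irreflexive induced_adj.
Proof. by move=> x; apply: adj_irr. Qed.
Definition induced : sgraph := SGraph induced_sym induced_irr.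
End Induced.

(* The set S may be empty, so the graph without vertices is an induced
   subgraph of every graph. *)
Definition induced_subgraph (H X : sgraph) : Prop :=
  exists S : {set X}, graph_iso H (induced S).

Section CompleteGraph.
Variable r : nat.
Definition Kn_adj : rel 'I_r := fun x y => x != y.
Fact Kn_sym : symmetric Kn_adj.
Proof. by move=> x y; rewrite /Kn_adj eq_sym. Qed.
Fact Kn_irr : irreflexive Kn_adj.
Proof. by move=> x; rewrite /Kn_adj eqxx. Qed.
Definition Kn : sgraph := SGraph Kn_sym Kn_irr.
End CompleteGraph.

(* This is the cycle C_r for r >= 3; ordS is the cyclic successor on 'I_r.
   The condition x != y only matters for r = 1. *)
Section Cycle.
Variable r : nat.
Definition Cn_adj : rel 'I_r :=
  fun x y => (x != y) && ((ordS x == y) || (ordS y == x)).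
Fact Cn_sym : symmetric Cn_adj.
Proof. by move=> x y; rewrite /Cn_adj eq_sym orbC. Qed.
Fact Cn_irr : irreflexive Cn_adj.
Proof. by move=> x; rewrite /Cn_adj eqxx. Qed.
Definition Cn : sgraph := SGraph Cn_sym Cn_irr.
End Cycle.

Section DisjointUnion.
Variables G H : sgraph.
Definition dunion_adj : rel (G + H)%type := fun u v =>
  match u, v with
  | inl x, inl y => adj x y
  | inr x, inr y => adj x y
  | _, _ => false
  end.
Fact dunion_sym : symmetric dunion_adj.
Proof. by case=> x [] y //=; apply: adj_sym. Qed.
Fact dunion_irr : irreflexive dunion_adj.
Proof. by case=> x /=; apply: adj_irr. Qed.
Definition dunion : sgraph := SGraph dunion_sym dunion_irr.
End DisjointUnion.

Definition two_copies (H : sgraph) : sgraph := dunion H H.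

Definition clique (G : sgraph) (K : {set G}) : Prop :=
  {in K &, forall x y, x != y -> adj x y}.

Definition stable (G : sgraph) (S : {set G}) : Prop :=
  {in S &, forall x y, ~~ adj x y}.

Definition complete_graph (G : sgraph) : Prop := clique [set: G].

Definition edgeless (G : sgraph) : Prop := stable [set: G].

Definition split_graph (G : sgraph) : Prop :=
  exists K S : {set G}, [/\ K :|: S = [set: G], clique K & stable S].

(* Sets and classes of graphs are predicates on sgraph. *)
Definition hfree (HH : sgraph -> Prop) (G : sgraph) : Prop :=
  forall H : sgraph, HH H -> ~ induced_subgraph H G.

Definition graph_pair (H1 H2 : sgraph) : sgraph -> Prop :=
  fun H => H = H1 \/ H = H2.

Definition apex_split (c : nat) (CC : sgraph -> Prop) : Prop :=
  forall G : sgraph, CC G ->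
    exists X : {set G}, #|X| <= c /\ split_graph (induced (~: X)).

Definition up_to_swap (P : sgraph -> sgraph -> Prop) (H1 H2 : sgraph) : Prop :=
  P H1 H2 \/ P H2 H1.

Definition case1 (H1 H2 : sgraph) : Prop :=
  induced_subgraph H1 (Kn 2) \/ induced_subgraph H1 (two_copies (Kn 1)).

Definition case2 (H1 H2 : sgraph) : Prop :=
  induced_subgraph H1 (Cn 4) /\ induced_subgraph H2 (two_copies (Kn 2)).

Definition case3 (H1 H2 : sgraph) : Prop :=
  complete_graph H1 /\ edgeless H2.

(* Main.v *)
Require Import Defs.
From mathcomp Require Import all_boot zify.

Set Implicit Arguments.
Unset Strict Implicit.
Unset Printing Implicit Defensive.

(** Necessity.  On the vertex set [T * bool], join two distinct pairs when
    their indices agree, when their indices differ, when their sides agree, or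
    when their sides differ.  For large [T] these four grids are a large
    matching, a cocktail party graph (the complement of a matching), two
    disjoint large cliques, and a large complete bipartite graph.  If only [c]
    of the [c + 2] rows are damaged, two full rows survive, and these carry an
    induced [2K_2] or [C_4], so no grid becomes split after [c] deletions
    ([grid_not_apex_split]).  Hence each of the four grids contains [H1] or
    [H2].  It remains to see which graphs embed in two of the grids.  The
    number of edges spanned by three vertices of the grids is at most 1, at
    least 2, odd, and even, respectively.  A graph with at least three
    vertices therefore cannot embed in a grid and in its complement; in a
    matching and a complete bipartite graph it is edgeless; in a cocktail
    party graph and two cliques it is complete.  In the two remaining
    combinations it embeds in [2K_2] or in [C_4].  Distributing the four grids
    over [H1] and [H2] leaves exactly the cases of the theorem
    ([cases_of_apex_split]).

    Sufficiency.  When one of the graphs has at most two vertices, a graph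
    free of it has no edge or no non-edge.  When one is complete and the other
    edgeless, Ramsey's theorem bounds the order of a free graph, and all its
    vertices may be deleted.  The remaining case is that of graphs without
    induced [C_4] and [2K_2] ([C4_2K2_free_apex_split]).  In such a graph take
    a clique [K] of maximum weight, where a vertex weighs its degree plus the
    order of the graph.  An edge outside [K] allows exchanges of vertices, and
    the only outcome compatible with maximality is an induced [C_5].  If there
    is no such edge, the graph is split.  If there is an induced [C_5], every
    other vertex is adjacent to all or to none of it, and deleting one vertex
    of the cycle leaves a split graph ([C5_split]). *)

(** * Embeddings *)

(** Containment through an injection avoids the subtype of a vertex set that
    occurs in [induced_subgraph]. *)
Definition embeds (H G : sgraph) : Prop :=
  exists2 f : H -> G, injective f & forall x y, adj (f x) (f y) = adj x y.

Lemma induced_subgraphP (H G : sgraph) : induced_subgraph H G <-> embeds H G.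
Proof.
split=> [[S [f fbij fadj]] | [f finj fadj]].
  exists (val \o f) => [|x y]; first exact: inj_comp val_inj (bij_inj fbij).
  by rewrite -fadj.
exists (f @: [set: H]).
have fS x : f x \in f @: [set: H] by apply: imset_f.
exists (fun x => exist _ (f x) (fS x)) => [|x y]; last exact: fadj.
apply: inj_card_bij => [x y /(congr1 val) /finj // |].
by rewrite card_sig (card_imset _ finj) cardsT.
Qed.

Lemma embeds_trans (F G H : sgraph) : embeds F G -> embeds G H -> embeds F H.
Proof.
move=> [f finj fadj] [g ginj gadj].
by exists (g \o f) => [|x y]; [apply: inj_comp | rewrite /= gadj fadj].
Qed.

Lemma embedsP (H G : sgraph) :
  reflect (embeds H G)
    [exists f : {ffun H -> G},
       injectiveb f && [forall x, forall y, adj (f x) (f y) == adj x y]].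
Proof.
apply: (iffP existsP) => [[f /andP[/injectiveP finj fadj]] | [f finj fadj]].
  by exists f => // x y; apply/eqP; move: fadj => /forallP/(_ x)/forallP/(_ y).
exists (finfun f); apply/andP; split.
  by apply/injectiveP=> x y; rewrite !ffunE => /finj.
by apply/forallP=> x; apply/forallP=> y; rewrite !ffunE fadj.
Qed.

(** Finiteness makes containment decidable, so failing to be free yields an
    actual copy of one of the two graphs without classical reasoning. *)
Lemma not_hfree_pair (H1 H2 G : sgraph) :
  ~ hfree (graph_pair H1 H2) G -> embeds H1 G \/ embeds H2 G.
Proof.
move=> nfree.
case: (embedsP H1 G) => [|n1]; first by left.
case: (embedsP H2 G) => [|n2]; first by right.
by case: nfree => H [] -> /induced_subgraphP.
Qed.

Lemma hfree_pairP (H1 H2 G : sgraph) :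
  hfree (graph_pair H1 H2) G -> ~ embeds H1 G /\ ~ embeds H2 G.
Proof.
by move=> Gfree; split=> /induced_subgraphP; apply: Gfree; [left | right].
Qed.

Lemma apex_split_swap c (H1 H2 : sgraph) :
  apex_split c (hfree (graph_pair H1 H2)) ->
  apex_split c (hfree (graph_pair H2 H1)).
Proof.
move=> spl G Gfree; apply: spl => H HH; apply: Gfree.
by case: HH; [right | left].
Qed.

Lemma card_le_injection (T U : finType) (A : {set U}) :
  #|T| <= #|A| -> exists2 f : T -> U, injective f & forall x, f x \in A.
Proof.
move=> leTA; exists (fun x => enum_val (widen_ord leTA (enum_rank x))).
  by move=> x y /enum_val_inj /(congr1 val) /= /val_inj /enum_rank_inj.
by move=> x; apply: enum_valP.
Qed.

Lemma complete_embeds (H G : sgraph) (K : {set G}) :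
  complete_graph H -> clique K -> #|H| <= #|K| -> embeds H G.
Proof.
move=> Hcomp Kcl /card_le_injection[f finj fK]; exists f => // x y.
have [-> | xy] := eqVneq x y; first by rewrite !adj_irr.
by rewrite Hcomp ?inE // Kcl // (inj_eq finj).
Qed.

Lemma edgeless_embeds (H G : sgraph) (S : {set G}) :
  edgeless H -> stable S -> #|H| <= #|S| -> embeds H G.
Proof.
move=> Hst Sst /card_le_injection[f finj fS]; exists f => // x y.
by rewrite (negbTE (Hst _ _ _ _)) ?inE // (negbTE (Sst _ _ _ _)).
Qed.

Lemma complete_Kn n : complete_graph (Kn n).
Proof. by move=> x y. Qed.

Lemma edgeless_2K1 : edgeless (two_copies (Kn 1)).
Proof. by move=> [x|x] [y|y] _ _ //=; rewrite !ord1. Qed.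

Lemma card_2K1 : #|two_copies (Kn 1)| = 2.
Proof. by rewrite card_sum !card_ord. Qed.

Lemma complete_or_edgeless_small (H : sgraph) :
  #|H| <= 2 -> complete_graph H \/ edgeless H.
Proof.
move=> H2.
have [/forallP adjH | /forallPn[x /forallPn[y]]] :=
    boolP [forall x : H, forall y : H, (x != y) ==> adj x y].
  by left=> x y _ _ xy; move/forallP/(_ y)/implyP: (adjH x); apply.
rewrite negb_imply => /andP[xy nxy]; right=> u v _ _.
have inxy w : w \in [set x; y].
  have /eqP -> : [set x; y] == [set: H].
    by rewrite eqEcard subsetT cardsT cards2 xy.
  by rewrite inE.
have := inxy u; have := inxy v; rewrite !inE.
by do 2 case/orP=> /eqP->; rewrite ?adj_irr // adj_sym.
Qed.

Lemma small_case1 (H1 H2 : sgraph) : #|H1| <= 2 -> case1 H1 H2.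
Proof.
move=> H1_2; have [Hc | He] := complete_or_edgeless_small H1_2; [left | right].
  apply/induced_subgraphP/(complete_embeds Hc (@complete_Kn 2)).
  by rewrite cardsT card_ord.
apply/induced_subgraphP/(edgeless_embeds He edgeless_2K1).
by rewrite cardsT card_2K1.
Qed.

(** Working with subsets of the ambient graph keeps the subtype of
    undeleted vertices out of the later arguments. *)
Lemma split_inducedP (G : sgraph) (A : {set G}) :
  split_graph (induced A) <->
  exists K S : {set G}, [/\ A \subset K :|: S, clique K & stable S].
Proof.
split=> [[K [S [KS Kcl Sst]]] | [K [S [/subsetP KS Kcl Sst]]]].
  exists (val @: K), (val @: S); split.
  - apply/subsetP=> x xA.
    have : exist _ x xA \in K :|: S by rewrite KS inE.
    by rewrite !inE => /orP[] /(imset_f val) /= ->; rewrite ?orbT.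
  - move=> _ _ /imsetP[x xK ->] /imsetP[y yK ->] xy.
    by apply: (Kcl x y xK yK); apply: contraNneq xy => ->.
  - by move=> _ _ /imsetP[x xS ->] /imsetP[y yS ->]; apply: (Sst x y xS yS).
exists [set x | val x \in K], [set x | val x \in S]; split.
- by apply/setP=> x; rewrite !inE; have := KS _ (valP x); rewrite inE.
- by move=> x y; rewrite !inE => xK yK xy; apply: Kcl.
- by move=> x y; rewrite !inE => xS yS; apply: Sst.
Qed.

(** * Graphs that are far from split *)

(** Two rows [i], [j] of a grid form a four-vertex graph whose pairs fall
    into three kinds (within rows, within sides, diagonals) controlled by
    [phi true false], [phi false true] and [phi false false]. *)
Section Grid.
Variables (T : finType) (phi : bool -> bool -> bool).

Definition grid_adj : rel (T * bool) :=
  fun x y => (x != y) && phi (x.1 == y.1) (x.2 == y.2).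
Fact grid_sym : symmetric grid_adj.
Proof.
by move=> x y; rewrite /grid_adj eq_sym (eq_sym x.1) (eq_sym x.2).
Qed.
Fact grid_irr : irreflexive grid_adj.
Proof. by move=> x; rewrite /grid_adj eqxx. Qed.
Definition grid : sgraph := SGraph grid_sym grid_irr.

End Grid.

(** A set of [c] vertices meets at most [c] rows, so two rows [i] and [j] survive
    intact.  When [phi] tells rows from sides, the four vertices of these rows
    induce [2K_2] or [C_4], neither of which is covered by a clique and a
    stable set. *)
Lemma grid_not_apex_split c phi (X : {set grid 'I_c.+2 phi}) :
  phi true false != phi false true ->
  #|X| <= c -> ~ split_graph (induced (~: X)).
Proof.
move=> phi_neq Xc /split_inducedP[K [S [/subsetP KS Kcl Sst]]].
have /card_gt1P[i [j [iI jI ij]]] : 1 < #|~: [set x.1 | x in X]|.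
  rewrite cardsCs setCK card_ord.
  have : #|[set x.1 | x in X]| <= #|X| by apply: leq_imset_card.
  by lia.
have inKS k b : k \in ~: [set x.1 | x in X] -> ((k, b) \in K) || ((k, b) \in S).
  rewrite inE => kX; rewrite -in_setU; apply: KS; rewrite inE.
  by apply: contra kX => kX; apply/imsetP; exists (k, b).
have pair (x y : 'I_c.+2 * bool) : x != y ->
    ((x \in K) && (y \in K) ==> phi (x.1 == y.1) (x.2 == y.2)) &&
    ((x \in S) && (y \in S) ==> ~~ phi (x.1 == y.1) (x.2 == y.2)).
  move=> xy; apply/andP; split; apply/implyP=> /andP[xin yin].
    by have := Kcl x y xin yin xy; rewrite /= /grid_adj xy.
  by have := Sst x y xin yin; rewrite /= /grid_adj xy.
(* A clique or stable set constrains the six pairs among the four vertices;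
   all ways of distributing the vertices are then refuted by computation. *)
have row k := pair (k, true) (k, false).
have col b := pair (i, b) (j, b).
have diag b := pair (i, b) (j, ~~ b).
move: (row i) (row j) (col true) (col false) (diag true) (diag false).
rewrite /= !xpair_eqE !eqxx (negbTE ij) /=.
move/(_ isT) => ri /(_ isT) rj /(_ isT) ct /(_ isT) cf /(_ isT) dt /(_ isT) df.
move: (inKS i true iI) (inKS i false iI) (inKS j true jI) (inKS j false jI).
move: phi_neq ri rj ct cf dt df.
case: (phi true false); case: (phi false true); case: (phi false false) => //= _;
case: ((i, true) \in K); case: ((i, true) \in S) => //=;
case: ((i, false) \in K); case: ((i, false) \in S) => //=;
case: ((j, true) \in K); case: ((j, true) \in S) => //=;
case: ((j, false) \in K); case: ((j, false) \in S) => //=.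
Qed.

(** * Edge counts of triples *)

Definition triple_edges (G : sgraph) (x y z : G) : nat :=
  adj x y + adj y z + adj x z.

Definition all_triples (P : pred nat) (G : sgraph) : Prop :=
  forall x y z : G, uniq [:: x; y; z] -> P (triple_edges x y z).

Lemma all_triples_embeds P (H G : sgraph) :
  embeds H G -> all_triples P G -> all_triples P H.
Proof.
move=> [f finj fadj] PG x y z uxyz.
by have := PG (f x) (f y) (f z); rewrite /triple_edges !fadj; apply;
  rewrite -(map_inj_uniq finj) in uxyz.
Qed.

(** The four rules give, in this order: a perfect matching, its complement, two
    disjoint cliques, and a complete bipartite graph. *)
Definition same_index (s t : bool) := s.
Definition other_index (s t : bool) := ~~ s.
Definition same_side (s t : bool) := t.
Definition other_side (s t : bool) := ~~ t.

Section GridTriples.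
Variable T : finType.

Let gridE phi (i j : T) (s t : bool) :
  @adj (grid T phi) (i, s) (j, t) =
    ~~ ((i == j) && (s == t)) && phi (i == j) (s == t).
Proof. by rewrite /= /grid_adj xpair_eqE. Qed.

(** Only the equalities among the three indices matter for the edge count of a
    triple, and by transitivity they cannot hold for exactly two of the three
    pairs.  The sides are booleans, so a finite check remains. *)
Lemma grid_triples phi (P : pred nat) :
  (forall p q r s t u : bool, (p + q + r != 2) ->
     let e a b := ~~ (a && b) && phi a b in
     [&& ~~ (p && (s == t)), ~~ (q && (t == u)) & ~~ (r && (s == u))] ->
     P (e p (s == t) + e q (t == u) + e r (s == u))) ->
  all_triples P (grid T phi).
Proof.
move=> phiP [i s] [j t] [k u]; rewrite /triple_edges !gridE /= !inE !xpair_eqE.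
rewrite negb_or andbT => /andP[/andP[ij ik] jk].
apply: phiP; last by rewrite ij ik jk.
have [-> | ij'] := eqVneq i j; first by case: (j == k).
by have [<- | _] := eqVneq j k; [rewrite (negbTE ij') | case: (i == k)].
Qed.

Lemma same_index_triples : all_triples (leq^~ 1) (grid T same_index).
Proof. by apply: grid_triples; do 6!case. Qed.

Lemma other_index_triples : all_triples (leq 2) (grid T other_index).
Proof. by apply: grid_triples; do 6!case. Qed.

Lemma same_side_triples : all_triples odd (grid T same_side).
Proof. by apply: grid_triples; do 6!case. Qed.

Lemma other_side_triples : all_triples (predC odd) (grid T other_side).
Proof. by apply: grid_triples; do 6!case. Qed.

End GridTriples.

Lemma no_triples_small (H : sgraph) : all_triples pred0 H -> #|H| <= 2.
Proof.
move=> H0; rewrite leqNgt; apply/negP=> /card_gt2P[x [y [z [_ [xy yz zx]]]]].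
suff /H0 : uniq [:: x; y; z] by [].
by rewrite /= !inE negb_or xy yz eq_sym zx.
Qed.

Lemma third_vertex (H : sgraph) (x y : H) :
  2 < #|H| -> exists z, z \notin [:: x; y].
Proof.
move=> H3; apply/existsP; rewrite -negb_forall; apply/forallP=> all_xy.
have : #|H| <= size [:: x; y].
  by rewrite -cardsT; apply: leq_trans (card_size _); apply/subset_leq_card/subsetP.
by rewrite leqNgt H3.
Qed.

Section TwoGrids.
Variables (n : nat) (H : sgraph).

Lemma all_triples_two_grids P Q phi psi :
  all_triples P (grid 'I_n phi) -> all_triples Q (grid 'I_n psi) ->
  embeds H (grid 'I_n phi) -> embeds H (grid 'I_n psi) ->
  all_triples (predI P Q) H.
Proof.
move=> HP HQ ephi epsi x y z u; apply/andP.
by split; [apply: (all_triples_embeds ephi HP) | apply: (all_triples_embeds epsi HQ)].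
Qed.

Lemma index_grids_small :
  embeds H (grid 'I_n same_index) -> embeds H (grid 'I_n other_index) ->
  #|H| <= 2.
Proof.
move=> e e'; apply: no_triples_small => x y z u.
have /= := all_triples_two_grids (@same_index_triples _) (@other_index_triples _) e e' u.
by lia.
Qed.

Lemma side_grids_small :
  embeds H (grid 'I_n same_side) -> embeds H (grid 'I_n other_side) ->
  #|H| <= 2.
Proof.
move=> e e'; apply: no_triples_small => x y z u.
have /= := all_triples_two_grids (@same_side_triples _) (@other_side_triples _) e e' u.
by rewrite andbN.
Qed.

Lemma mixed_grids_complete :
  2 < #|H| ->
  embeds H (grid 'I_n other_index) -> embeds H (grid 'I_n same_side) ->
  complete_graph H.
Proof.
move=> H3 e e' x y _ _ xy; have [z] := third_vertex x y H3.
rewrite !inE negb_or => /andP[zx zy].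
have := all_triples_two_grids (@other_index_triples _) (@same_side_triples _) e e'.
move/(_ x y z); rewrite /= !inE negb_or xy eq_sym zx eq_sym zy => /(_ isT).
by rewrite /triple_edges; do 3!case: (adj _ _).
Qed.

Lemma mixed_grids_edgeless :
  2 < #|H| ->
  embeds H (grid 'I_n same_index) -> embeds H (grid 'I_n other_side) ->
  edgeless H.
Proof.
move=> H3 e e' x y _ _; have [-> | xy] := eqVneq x y; first by rewrite adj_irr.
have [z] := third_vertex x y H3; rewrite !inE negb_or => /andP[zx zy].
have := all_triples_two_grids (@same_index_triples _) (@other_side_triples _) e e'.
move/(_ x y z); rewrite /= !inE negb_or xy eq_sym zx eq_sym zy => /(_ isT).
by rewrite /triple_edges; do 3!case: (adj _ _).
Qed.

(** The two cliques split [H] into its side classes; within a clique the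
    matching allows only one edge, whose ends lie on different sides of the
    matching.  So the pair of sides in the two grids determines a vertex. *)
Lemma grids_embed_2K2 :
  embeds H (grid 'I_n same_index) -> embeds H (grid 'I_n same_side) ->
  embeds H (two_copies (Kn 2)).
Proof.
move=> [f finj fadj] [g ginj gadj].
pose b2 (b : bool) : Kn 2 := inord b.
have b2_eq a b : (b2 a == b2 b) = (a == b).
  by rewrite -val_eqE /= !inordK //; case: a b => [] [].
have gf x y : x != y -> (g x).2 = (g y).2 -> (f x).2 != (f y).2.
  move=> xy gxy; have := gadj x y; have := fadj x y.
  rewrite /= /grid_adj (inj_eq finj) (inj_eq ginj) xy /= /same_index /same_side.
  rewrite gxy eqxx => <- /esym fxy; apply: contra xy => fxy2.
  by rewrite -(inj_eq finj) [f x]surjective_pairing [f y]surjective_pairing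
     xpair_eqE fxy.
exists (fun x => if (g x).2 then inl (b2 (f x).2) else inr (b2 (f x).2))
    => [x y fxy | x y].
  apply/eqP; apply: contraT => /gf.
  by move: fxy; case: (g x).2; case: (g y).2 => // -[] /eqP;
    rewrite b2_eq => -> /(_ erefl).
rewrite -gadj /= /grid_adj (inj_eq ginj) /same_side.
have [-> | /gf] := eqVneq x y; first by case: (g y).2; rewrite /= /Kn_adj eqxx.
by case: (g x).2; case: (g y).2 => //= /(_ erefl); rewrite /Kn_adj b2_eq.
Qed.

(** This is the complementary form of the argument for [2K_2]: the colour
    classes of the complete bipartite graph have at most two vertices, which
    the sides in the cocktail party graph separate. *)
Lemma grids_embed_C4 :
  embeds H (grid 'I_n other_index) -> embeds H (grid 'I_n other_side) ->
  embeds H (Cn 4).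
Proof.
move=> [f finj fadj] [g ginj gadj].
(* The colour class of a vertex of the cycle is its parity. *)
pose c4 (s t : bool) : Cn 4 := inord (s + t.*2).
have c4E s t : c4 s t = s + t.*2 :> nat by rewrite inordK //; case: s t => [] [].
have c4_adj s t s' t' : adj (c4 s t) (c4 s' t') = (s != s').
  by rewrite /= /Cn_adj -!val_eqE /= !c4E; case: s t s' t' => [] [] [] [].
exists (fun x => c4 (g x).2 (f x).2) => [x y /(congr1 val) | x y]; last first.
  rewrite c4_adj -gadj /= /grid_adj /other_side.
  by have [-> | //] := eqVneq (g x) (g y); rewrite eqxx.
rewrite /= !c4E => cxy.
have [gxy fxy] : (g x).2 = (g y).2 /\ (f x).2 = (f y).2.
  by move: cxy; case: (g x).2; case: (g y).2; case: (f x).2; case: (f y).2.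
apply/eqP; have := gadj x y; have := fadj x y.
rewrite /= /grid_adj (inj_eq finj) (inj_eq ginj) /other_index /other_side.
rewrite gxy eqxx andbF => <-.
have [//|xy /= /esym /negbFE fxy1] := eqVneq x y.
by rewrite -(inj_eq finj) [f x]surjective_pairing [f y]surjective_pairing
     xpair_eqE fxy1 fxy eqxx in xy.
Qed.

End TwoGrids.

(** Suppose both graphs have more than two vertices.  Say [H1] embeds in the
    matching; then [H2] must embed in its complement.  Likewise one of them
    embeds in the two cliques and the other one in the complete bipartite
    graph.  The two ways to choose are the second and the third case. *)
Lemma cases_of_apex_split c (H1 H2 : sgraph) :
  apex_split c (hfree (graph_pair H1 H2)) ->
  up_to_swap (fun A B => [\/ case1 A B, case2 A B | case3 A B]) H1 H2.
Proof.
move=> spl; have [H1s | H1b] := leqP #|H1| 2.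
  by left; apply: Or31; apply: small_case1.
have [H2s | H2b] := leqP #|H2| 2.
  by right; apply: Or31; apply: small_case1.
have grid_emb phi : phi true false != phi false true ->
    embeds H1 (grid 'I_c.+2 phi) \/ embeds H2 (grid 'I_c.+2 phi).
  move=> phi_neq; apply: not_hfree_pair => /spl[X [Xc]].
  exact: grid_not_apex_split.
wlog H1m : H1 H2 H1b H2b spl grid_emb / embeds H1 (grid 'I_c.+2 same_index).
  move=> IH; have [H1m | H2m] := grid_emb same_index isT; first exact: (IH H1 H2).
  have := IH H2 H1; rewrite /up_to_swap => IH'; apply/or_comm; apply: IH' => //.
    exact: apex_split_swap.
  by move=> phi /grid_emb /or_comm.
have big_index (H : sgraph) : 2 < #|H| -> embeds H (grid 'I_c.+2 same_index) ->
    ~ embeds H (grid 'I_c.+2 other_index).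
  by move=> H3 e /(index_grids_small e); rewrite leqNgt H3.
have big_side (H : sgraph) : 2 < #|H| -> embeds H (grid 'I_c.+2 same_side) ->
    ~ embeds H (grid 'I_c.+2 other_side).
  by move=> H3 e /(side_grids_small e); rewrite leqNgt H3.
have H2om : embeds H2 (grid 'I_c.+2 other_index).
  by case: (grid_emb other_index isT) => // /(big_index _ H1b H1m).
right; have [H1s | H2s] := grid_emb same_side isT.
  have H2os : embeds H2 (grid 'I_c.+2 other_side).
    by case: (grid_emb other_side isT) => // /(big_side _ H1b H1s).
  apply: Or32; split; apply/induced_subgraphP.
    exact: grids_embed_C4 H2om H2os.
  exact: grids_embed_2K2 H1m H1s.
have H1os : embeds H1 (grid 'I_c.+2 other_side).
  by case: (grid_emb other_side isT) => // /(big_side _ H2b H2s).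
apply: Or33; split; first exact: mixed_grids_complete H2om H2s.
exact: mixed_grids_edgeless H1m H1os.
Qed.

(** * Graphs with no edge or no non-edge *)

Lemma no_edge_or_nonedge_split (G : sgraph) :
  complete_graph G \/ edgeless G -> split_graph (induced (~: (set0 : {set G}))).
Proof.
move=> G_triv; apply/split_inducedP.
case: G_triv => [Gc | Ge]; [exists setT, set0 | exists set0, setT].
  by split; rewrite ?setU0 ?subsetT // => x y; rewrite inE.
by split; rewrite ?setUT ?subsetT // => x y; rewrite inE.
Qed.

Lemma case1_apex_split (H1 H2 : sgraph) :
  case1 H1 H2 -> apex_split 0 (hfree (graph_pair H1 H2)).
Proof.
move=> H1_small G /hfree_pairP[nH1 _]; exists set0; rewrite cards0; split=> //.
apply: no_edge_or_nonedge_split.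
case: H1_small => /induced_subgraphP eH1; [right | left] => x y _ _.
  apply/negP=> xy; apply: nH1; apply: (embeds_trans eH1).
  apply: (@complete_embeds _ _ [set x; y]); first exact: complete_Kn.
    move=> u v; rewrite !inE => /orP[] /eqP-> /orP[] /eqP->; rewrite ?eqxx //.
    by rewrite adj_sym.
  by rewrite card_ord cards2; case: eqVneq xy => // ->; rewrite adj_irr.
move=> xy; apply: contraT => nxy; case: nH1; apply: (embeds_trans eH1).
apply: (@edgeless_embeds _ _ [set x; y]); first exact: edgeless_2K1.
  move=> u v; rewrite !inE => /orP[] /eqP-> /orP[] /eqP->; rewrite ?adj_irr //.
  by rewrite adj_sym.
by rewrite card_2K1 cards2 xy.
Qed.

(** * Ramsey's theorem and large graphs *)

Lemma clique_setU1 (G : sgraph) (K : {set G}) x :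
  clique K -> {in K, forall u, adj x u} -> clique (x |: K).
Proof.
move=> Kcl xK u v /setU1P[-> | uK] /setU1P[-> | vK] uv; last exact: Kcl.
- by rewrite eqxx in uv.
- exact: xK.
- by rewrite adj_sym xK.
Qed.

Lemma stable_setU1 (G : sgraph) (S : {set G}) x :
  stable S -> {in S, forall u, ~~ adj x u} -> stable (x |: S).
Proof.
move=> Sst xS u v /setU1P[-> | uS] /setU1P[-> | vS]; last exact: Sst.
- by rewrite adj_irr.
- exact: xS.
- by rewrite adj_sym xS.
Qed.

(** The set is split at a vertex [v] into neighbours and non-neighbours; one
    of the two parts has at least half of the required size, and [v] extends
    the clique or the stable set found there.  The crude bound [2 ^ (r + s)]
    makes the halving exact. *)
Lemma ramsey (G : sgraph) r s (A : {set G}) :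
  2 ^ (r + s) <= #|A| ->
  (exists K : {set G}, [/\ K \subset A, clique K & r <= #|K|]) \/
  (exists S : {set G}, [/\ S \subset A, stable S & s <= #|S|]).
Proof.
have [m] := ubnP (r + s); elim: m => // m IH in r s A *.
case: r => [|r] lm leA.
  by left; exists set0; split; rewrite ?sub0set // => x y; rewrite inE.
case: s => [|s] in lm leA *.
  by right; exists set0; split; rewrite ?sub0set // => x y; rewrite inE.
have /card_gt0P[v vA] : 0 < #|A| by apply: leq_trans leA; rewrite expn_gt0.
pose N := [set x in A :\ v | adj v x]; pose M := [set x in A :\ v | ~~ adj v x].
have NM : (#|N| + #|M|).+1 = #|A|.
  rewrite (cardsD1 v A) vA add1n -(cardsID [set x | adj v x] (A :\ v)).
  by congr (_ + _).+1; apply: eq_card => x; rewrite !inE // andbC.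
have [leN | leM] : 2 ^ (r + s.+1) <= #|N| \/ 2 ^ (r.+1 + s) <= #|M|.
  by move: leA; rewrite -NM (addSnnS r s) addSn expnS; lia.
- have [|[K [KN Kcl rK]]|[S [SN Sst sS]]] := IH _ _ _ _ leN; first by lia.
  + left; exists (v |: K); split.
    * rewrite subUset sub1set vA; apply: subset_trans KN _.
      by apply/subsetP=> x; rewrite !inE => /andP[/andP[]].
    * apply: clique_setU1 => // x /(subsetP KN); rewrite inE.
      by case/andP.
    * rewrite cardsU1; suff -> : v \notin K by [].
      by apply/negP=> /(subsetP KN); rewrite !inE eqxx.
  + right; exists S; split=> //; apply: subset_trans SN _.
    by apply/subsetP=> x; rewrite !inE => /andP[/andP[]].
- have [|[K [KM Kcl rK]]|[S [SM Sst sS]]] := IH _ _ _ _ leM; first by lia.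
  + left; exists K; split=> //; apply: subset_trans KM _.
    by apply/subsetP=> x; rewrite !inE => /andP[/andP[]].
  + right; exists (v |: S); split.
    * rewrite subUset sub1set vA; apply: subset_trans SM _.
      by apply/subsetP=> x; rewrite !inE => /andP[/andP[]].
    * apply: stable_setU1 => // x /(subsetP SM); rewrite inE.
      by case/andP.
    * rewrite cardsU1; suff -> : v \notin S by [].
      by apply/negP=> /(subsetP SM); rewrite !inE eqxx.
Qed.

Lemma case3_apex_split (H1 H2 : sgraph) :
  case3 H1 H2 ->
  apex_split (2 ^ (#|H1| + #|H2|)) (hfree (graph_pair H1 H2)).
Proof.
move=> [H1c H2e] G /hfree_pairP[nH1 nH2].
have [/ramsey | small] := leqP (2 ^ (#|H1| + #|H2|)) #|[set: G]|.
  case=> [[K [_ Kcl H1K]] | [S [_ Sst H2S]]].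
    by case: nH1; apply: (complete_embeds H1c Kcl).
  by case: nH2; apply: (edgeless_embeds H2e Sst).
exists setT; split; first exact: ltnW.
apply/split_inducedP; exists set0, set0.
by split; rewrite ?setCT ?sub0set // => x y; rewrite inE.
Qed.

(** * Graphs without induced four-cycles and 2K_2 *)

Definition C4_free (G : sgraph) : Prop := forall a b c d : G,
  adj a b -> adj b c -> adj c d -> adj d a -> a != c -> b != d ->
  adj a c || adj b d.

(** Two edges share no vertex as soon as none of the four cross pairs is
    adjacent. *)
Definition twoK2_free (G : sgraph) : Prop := forall a b c d : G,
  adj a b -> adj c d -> [|| adj a c, adj a d, adj b c | adj b d].

Lemma not_embeds_C4 (G : sgraph) : ~ embeds (Cn 4) G -> C4_free G.
Proof.
move=> nC4 a b c d ab bc cd da ac bd; apply: contraT; rewrite negb_or.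
move=> /andP[nac nbd]; case: nC4;
  exists (fun i : Cn 4 => nth a [:: a; b; c; d] (i : 'I_4)).
  move=> i j /eqP; rewrite nth_uniq ?ltn_ord //= => [/eqP /val_inj // |].
  have adj_neq (x y : G) : adj x y -> x != y.
    by apply: contraTneq => ->; rewrite adj_irr.
  by rewrite !inE !negb_or ac bd !adj_neq // adj_sym.
case=> [[|[|[|[|i]]]] //= ?] [[|[|[|[|j]]]] //= ?];
  rewrite /Cn_adj -!val_eqE /= ?adj_irr ?ab ?bc ?cd ?da ?(negbTE nac) ?(negbTE nbd) //;
  by rewrite adj_sym ?ab ?bc ?cd ?da ?(negbTE nac) ?(negbTE nbd).
Qed.

Lemma not_embeds_2K2 (G : sgraph) : ~ embeds (two_copies (Kn 2)) G -> twoK2_free G.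
Proof.
move=> n2K2 a b c d ab cd; apply: contraT; rewrite !negb_or.
case/and4P=> nac nad nbc nbd; case: n2K2.
pose f (u : two_copies (Kn 2)) := match u with
  | inl i => nth a [:: a; b] (i : 'I_2)
  | inr i => nth a [:: c; d] (i : 'I_2) end.
have fadj u v : adj (f u) (f v) = adj u v.
  by case: u v => [[[|[|i]] //= ?]|[[|[|i]] //= ?]]
    [[[|[|j]] //= ?]|[[|[|j]] //= ?]]; rewrite /Kn_adj -?val_eqE /=
    ?adj_irr ?ab ?cd ?(negbTE nac) ?(negbTE nad) ?(negbTE nbc) ?(negbTE nbd) //
    adj_sym ?ab ?cd ?(negbTE nac) ?(negbTE nad) ?(negbTE nbc) ?(negbTE nbd).
exists f => // u v fuv.
(* No two vertices of [2K_2] have the same neighbours, so preserving adjacency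
   already forces injectivity. *)
have : forall w, adj u w = adj v w by move=> w; rewrite -!fadj fuv.
move=> uv {fadj f fuv}.
move: (uv (inl ord0)) (uv (inl ord_max)) (uv (inr ord0)) (uv (inr ord_max)).
by case: u v {uv} => [[[|[|i]] //= ?]|[[|[|i]] //= ?]]
  [[[|[|j]] //= ?]|[[|[|j]] //= ?]]; rewrite /Kn_adj -?val_eqE //= => _ _ _ _;
  congr (_ _); apply: val_inj.
Qed.

(** A vertex [x] off the cycle that sees one of its vertices sees one of the two
    opposite ones (no [2K_2]), and with two vertices at distance two it sees the
    one between them (no [C_4]); so it sees the whole cycle.  The vertices that
    see the cycle form a clique, since two of them that are not adjacent would
    form a [C_4] with [v1] and [v3]; those that miss it are stable, since an edge
    among them would form a [2K_2] with the edge [v1 v2].  Without [v5] the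
    cycle becomes a path whose inner vertices [v2], [v3] join the clique and
    whose ends [v1], [v4] join the stable set. *)
Lemma C5_split (G : sgraph) (v1 v2 v3 v4 v5 : G) :
  C4_free G -> twoK2_free G ->
  adj v1 v2 -> adj v2 v3 -> adj v3 v4 -> adj v4 v5 -> adj v5 v1 ->
  ~~ adj v1 v3 -> ~~ adj v2 v4 -> ~~ adj v3 v5 -> ~~ adj v4 v1 -> ~~ adj v5 v2 ->
  split_graph (induced (~: [set v5])).
Proof.
move=> C4f K2f a12 a23 a34 a45 a51 n13 n24 n35 n41 n52.
have [a21 a32 a43 a54 a15] :
    [/\ adj v2 v1, adj v3 v2, adj v4 v3, adj v5 v4 & adj v1 v5].
  by split; rewrite adj_sym.
have [n31 n42 n53 n14 n25] :
    [/\ ~~ adj v3 v1, ~~ adj v4 v2, ~~ adj v5 v3, ~~ adj v1 v4 & ~~ adj v2 v5].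
  by split; rewrite adj_sym.
have sep (u v w : G) : adj u w -> ~~ adj v w -> u != v.
  by move=> uw; apply: contraNneq => <-.
have fill (x u v w : G) : x != v -> adj u v -> adj v w -> u != w -> ~~ adj u w ->
    adj x u && adj x w ==> adj x v.
  move=> xv uv vw uw nuw; apply/implyP=> /andP[xu xw].
  by have := C4f x u v w xu uv vw; rewrite [adj w x]adj_sym xw (negbTE nuw) orbF => ->.
have meet (x u v w : G) : adj v w -> ~~ adj u v -> ~~ adj u w ->
    adj x u ==> adj x v || adj x w.
  move=> vw nuv nuw; apply/implyP=> xu.
  by have := K2f x u v w xu vw; rewrite (negbTE nuv) (negbTE nuw) !orbF.
pose vs := [:: v1; v2; v3; v4; v5].
have uniform x : x \notin vs -> all (adj x) vs || all (predC (adj x)) vs.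
  rewrite !inE !negb_or => /and5P[x1 x2 x3 x4 x5].
  have := fill x _ _ _ x2 a12 a23 (sep _ _ _ a15 n35) n13.
  have := fill x _ _ _ x3 a23 a34 (sep _ _ _ a21 n41) n24.
  have := fill x _ _ _ x4 a34 a45 (sep _ _ _ a32 n52) n35.
  have := fill x _ _ _ x5 a45 a51 (sep _ _ _ a43 n13) n41.
  have := fill x _ _ _ x1 a51 a12 (sep _ _ _ a54 n24) n52.
  have := meet x v1 v3 v4 a34 n13 n14.
  have := meet x v2 v4 v5 a45 n24 n25.
  have := meet x v3 v5 v1 a51 n35 n31.
  have := meet x v4 v1 v2 a12 n41 n42.
  have := meet x v5 v2 v3 a23 n52 n53.
  rewrite /=; case: (adj x v1); case: (adj x v2); case: (adj x v3);
  by case: (adj x v4); case: (adj x v5).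
apply/split_inducedP.
exists (v2 |: (v3 |: [set x | all (adj x) vs])).
exists (v1 |: (v4 |: [set x | all (predC (adj x)) vs])); split.
- apply/subsetP=> x; rewrite in_setC1 => x5; rewrite in_setU !in_setU1.
  have := uniform x; rewrite !inE (negbTE x5) orbF.
  case: (x == v1); case: (x == v2); case: (x == v3); case: (x == v4) => //=;
    by rewrite ?orbT // => /(_ isT).
- have vN v : v \in vs -> {in [set x | all (adj x) vs], forall x, adj v x}.
    by move=> vvs x; rewrite inE adj_sym => /allP; apply.
  apply: clique_setU1; first apply: clique_setU1; last first.
  + by move=> x /setU1P[-> // | ]; apply: vN; rewrite !inE eqxx ?orbT.
  + by apply: vN; rewrite !inE eqxx ?orbT.
  + move=> x y; rewrite !inE => /and5P[x1 _ x3 _ _] /and5P[y1 _ y3 _ _] xy.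
    rewrite adj_sym in y1; rewrite adj_sym in x3.
    have := C4f x v1 y v3 x1 y1 y3 x3 xy (sep _ _ _ a15 n35).
    by rewrite (negbTE n13) orbF.
- have vM v : v \in vs ->
      {in [set x | all (predC (adj x)) vs], forall x, ~~ adj v x}.
    by move=> vvs x; rewrite inE adj_sym => /allP; apply.
  apply: stable_setU1; first apply: stable_setU1; last first.
  + by move=> x /setU1P[-> // | ]; apply: vM; rewrite !inE eqxx ?orbT.
  + by apply: vM; rewrite !inE eqxx ?orbT.
  + move=> x y; rewrite !inE => /and3P[x1 x2 _] /and3P[y1 y2 _].
    apply/negP=> xy; have := K2f x y v1 v2 xy a12.
    by rewrite (negbTE x1) (negbTE x2) (negbTE y1) (negbTE y2).
Qed.

Lemma cliqueP (G : sgraph) (K : {set G}) :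
  reflect (clique K) [forall x in K, forall y in K, (x != y) ==> adj x y].
Proof.
apply: (iffP forall_inP) => [Kcl x y xK yK xy | Kcl x xK].
  by have /forall_inP/(_ y yK)/implyP := Kcl x xK; apply.
by apply/forall_inP=> y yK; apply/implyP; apply: Kcl.
Qed.

Lemma max_weight_clique (G : sgraph) (w : G -> nat) :
  exists2 K : {set G}, clique K &
    forall L : {set G}, clique L -> \sum_(v in L) w v <= \sum_(v in K) w v.
Proof.
pose isclique (K : {set G}) :=
  [forall x in K, forall y in K, (x != y) ==> adj x y].
have cl0 : isclique set0 by apply/cliqueP=> x y; rewrite inE.
case: (arg_maxnP (fun K : {set G} => \sum_(v in K) w v) cl0) => K Kcl Kmax.
by exists K => [|L /cliqueP]; [apply/cliqueP | apply: Kmax].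
Qed.

(** Let [K] be a clique of maximum weight and suppose that an edge [x y] lies
    outside it.  Having no [C_4] makes the sets of non-neighbours of [x] and [y]
    in [K] nested, and having no [2K_2] makes the smaller one, say that of [x],
    a singleton [a].  Maximality gives another non-neighbour [b] of [y], since
    otherwise [a] could be traded for both [x] and [y].  Trading [a] for [x]
    shows that the degree of [a] is at least that of [x]; as [y] is adjacent to
    [x] only, some [z] is adjacent to [a] only.  Then [a z y x b] is an induced
    five-cycle. *)
Lemma C4_2K2_free_apex_split (G : sgraph) :
  C4_free G -> twoK2_free G ->
  exists X : {set G}, #|X| <= 1 /\ split_graph (induced (~: X)).
Proof.
move=> C4f K2f.
pose N (v : G) := [set u | adj v u].
(* The summand [#|G|] makes any two vertices outweigh a single one, while a
   one-for-one exchange still compares degrees. *)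
pose w (v : G) := #|G| + #|N v|.
have [K Kcl Kmax] := max_weight_clique w.
have [/forallP Kst | /forallPn[x /forallPn[y]]] := boolP
    [forall x, forall y, (x \notin K) && (y \notin K) ==> ~~ adj x y].
  exists set0; rewrite cards0; split=> //; apply/split_inducedP.
  exists K, (~: K); split=> // [|x y]; first by rewrite setUCr subsetT.
  by rewrite !inE => xK yK; move/forallP/(_ y): (Kst x); rewrite xK yK.
rewrite negb_imply negbK => /andP[/andP[xK yK] xy].
have sumU1 v (L : {set G}) : v \notin L ->
    \sum_(u in v |: L) w u = w v + \sum_(u in L) w u.
  by move=> vL; rewrite big_setU1.
have w0 v : 0 < w v by rewrite addn_gt0; apply/orP; left; apply/card_gt0P; exists v.
have maxK u : u \notin K -> exists2 a, a \in K & ~~ adj u a.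
  move=> uK; apply/exists_inP; rewrite -negb_forall_in.
  apply/negP=> /forall_inP /(clique_setU1 Kcl) /Kmax.
  by rewrite sumU1 //; move: (w0 u); lia.
have outside u a : u \notin K -> a \in K -> u != a.
  by move=> uK aK; apply: contraNneq uK => ->.
have nested a b : a \in K -> b \in K -> ~~ adj x a -> ~~ adj y b ->
    ~~ adj y a || ~~ adj x b.
  move=> aK bK nxa nyb; rewrite -negb_and; apply/negP=> /andP[ya xb].
  have ba : b != a by apply: contraNneq nyb => ->.
  have := C4f x b a y xb (Kcl _ _ bK aK ba).
  rewrite adj_sym ya adj_sym xy outside // eq_sym outside // => /(_ isT isT isT isT).
  by rewrite (negbTE nxa) adj_sym (negbTE nyb).
(* The non-neighbours of [x] in [K] may be taken to be the smaller set. *)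
wlog sub_xy : x y xK yK xy nested / {in K, forall a, ~~ adj x a -> ~~ adj y a}.
  move=> IH; have [/forall_inP xy_sub | ] :=
    boolP [forall a in K, ~~ adj x a ==> ~~ adj y a].
    by apply: (IH x y) => // a aK; apply/implyP; apply: xy_sub.
  rewrite negb_forall_in => /exists_inP[a aK]; rewrite negb_imply negbK.
  case/andP=> nxa ya; apply: (IH y x) => //; first by rewrite adj_sym.
    by move=> c d cK dK nyc nxd; rewrite orbC; apply: nested.
  move=> b bK nyb; have := nested a b aK bK nxa nyb.
  by rewrite ya.
have [a aK nxa] := maxK x xK.
have nya := sub_xy a aK nxa.
have onlya c : c \in K -> c != a -> adj x c.
  move=> cK ca; apply: contraT => nxc.
  have := K2f x y c a xy (Kcl _ _ cK aK ca).
  by rewrite (negbTE nxa) (negbTE nxc) (negbTE nya) (negbTE (sub_xy c cK nxc)).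
have clKa : clique (K :\ a).
  by move=> u v /setD1P[_ uK] /setD1P[_ vK]; apply: Kcl.
have clx : clique (x |: K :\ a).
  by apply: clique_setU1 => // c /setD1P[ca cK]; apply: onlya.
have xKa : x \notin K :\ a by rewrite inE (negbTE xK) andbF.
have sumK : \sum_(v in K) w v = w a + \sum_(v in K :\ a) w v.
  by rewrite (big_setD1 a aK).
have [b bK /andP[ba nyb]] : exists2 b, b \in K & (b != a) && ~~ adj y b.
  have [/forall_inP yadj | ] := boolP [forall b in K, (b != a) ==> adj y b];
    last first.
    rewrite negb_forall_in => /exists_inP[b bK]; rewrite negb_imply.
    by exists b.
  have cly : clique (y |: (x |: K :\ a)).
    apply: clique_setU1 => // c /setU1P[-> | /setD1P[ca cK]]; first by rewrite adj_sym.
    exact: implyP (yadj c cK) ca.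
  have /Kmax := cly; rewrite sumK sumU1 ?sumU1 //; last first.
    rewrite in_setU1 in_setD1 (negbTE yK) andbF orbF.
    by apply: contraTneq xy => ->; rewrite adj_irr.
  have : 0 < #|N x| by apply/card_gt0P; exists y; rewrite inE.
  have : #|N a| <= #|G| by apply: max_card.
  by rewrite /w; lia.
have xb := onlya b bK ba.
have Nxa : #|N x| <= #|N a|.
  by have /Kmax := clx; rewrite sumK sumU1 // leq_add2r leq_add2l.
have [z az nxz] : exists2 z, adj a z & ~~ adj x z.
  have /subsetPn[z] : ~~ (N a \subset N x).
    apply/negP=> NaNx; suff : N a \proper N x by move/proper_card; rewrite ltnNge Nxa.
    by apply/properP; split=> //; exists y; rewrite inE // adj_sym.
  by rewrite !inE => az nxz; exists z.
have zx : z != x by apply: contraTneq az => ->; rewrite adj_sym.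
have yz : adj y z.
  have := K2f x y a z xy az.
  by rewrite (negbTE nxa) (negbTE nxz) (negbTE nya).
have nbz : ~~ adj b z.
  apply/negP=> bz; have := C4f b z y x bz.
  rewrite adj_sym yz adj_sym xy xb eq_sym outside // zx => /(_ isT isT isT isT isT).
  by rewrite adj_sym (negbTE nyb) adj_sym (negbTE nxz).
exists [set b]; rewrite cards1; split=> //.
apply: (@C5_split _ a z y x b) => //; try by rewrite adj_sym.
exact: Kcl.
Qed.

Lemma case2_apex_split (H1 H2 : sgraph) :
  case2 H1 H2 -> apex_split 1 (hfree (graph_pair H1 H2)).
Proof.
move=> [/induced_subgraphP eH1 /induced_subgraphP eH2] G /hfree_pairP[nH1 nH2].
apply: C4_2K2_free_apex_split; [apply: not_embeds_C4 | apply: not_embeds_2K2].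
  by move=> /(embeds_trans eH1).
by move=> /(embeds_trans eH2).
Qed.

Theorem theorem8p2 (H1 H2 : sgraph) :
  [/\ (exists c : nat, apex_split c (hfree (graph_pair H1 H2))) <->
        up_to_swap
          (fun A B => [\/ case1 A B, case2 A B | case3 A B]) H1 H2,
      up_to_swap case1 H1 H2 -> apex_split 0 (hfree (graph_pair H1 H2))
    & up_to_swap case2 H1 H2 ->
        exists c : nat, c <= 1 /\ apex_split c (hfree (graph_pair H1 H2))].
Proof.
split=> [|[|] /case1_apex_split // /apex_split_swap // |].
  split=> [[c] | cases]; first exact: cases_of_apex_split.
  wlog {cases}: H1 H2 / [\/ case1 H1 H2, case2 H1 H2 | case3 H1 H2] => [sym|].
    case: cases => /sym // [c /apex_split_swap spl]; by exists c.
  case=> [/case1_apex_split | /case2_apex_split | /case3_apex_split].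
  - by exists 0.
  - by exists 1.
  - by exists (2 ^ (#|H1| + #|H2|)).
by case=> /case2_apex_split spl; exists 1; split=> //; apply: apex_split_swap.
Qed.
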